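(* Let $X$ be a Souslin space (e.g. a Polish space), and let $\mathcal{F}\subseteq\mathcal{C}_b(X)$ be a (not necessarily countable) set of bounded continuous $\mathbb{C}$-valued functions on $X$. Assume that (S.1) $\mathcal{F}$ is multiplicatively closed and closed under complex conjugation; (S.2) $\mathcal{F}$ separates points of $X$; (S.3) $\mathcal{F}$ vanishes nowhere, i.e. for every $x\in X$ there exists $f_x\in\mathcal{F}$ with $f_x(x)\neq 0$. Then $\mathcal{F}$ is separating for measures in $\mathcal{M}_{\mathcal{F}}(X)$, i.e. whenever $\mu_1,\mu_2\in\mathcal{M}_{\mathcal{F}}(X)$ satisfy $\int f\,d\mu_1=\int f\,d\mu_2$ for all $f\in\mathcal{F}$, then $\mu_1=\mu_2$.
   Context: A Souslin space is a Hausdorff topological space $X$ for which there exist a Polish space $Y$ and a continuous surjective map $Y\to X$. $\mathcal{C}_b(X)$ is the set of bounded continuous functions $X\to\mathbb{C}$. Measures are on the Borel $\sigma$-field of $X$; $\mathcal{M}(X)$ is the set of (non-negative, possibly infinite) measures on it, and $\mathcal{M}_{\mathcal{F}}(X)=\{\mu\in\mathcal{M}(X): \int|f|\,d\mu<\infty\ \forall f\in\mathcal{F}\}$. ''Multiplicatively closed'' means $f,g\in\mathcal{F}$ implies $fg\in\mathcal{F}$. *)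

(* Defs.v *)
From mathcomp Require Import all_boot all_order all_algebra.
From mathcomp Require Import complex.
From mathcomp Require Import all_classical all_reals all_analysis.

Set Implicit Arguments.
Unset Strict Implicit.
Unset Printing Implicit Defensive.

Import Order.TTheory GRing.Theory Num.Theory.
Import numFieldNormedType.Exports.

Local Open Scope classical_set_scope.
Local Open Scope ring_scope.
Local Open Scope complex_scope.

Definition separable_space (T : topologicalType) : Prop :=
  exists2 D : set T, countable D & dense D.

(* The library's completeType is pointed, hence nonempty; this is not. *)
Definition complete_metric (R : realType) (M : metricType R) : Prop :=
  forall u : nat -> M, cauchy (u @ \oo) -> exists l : M, u @ \oo --> l.

Definition homeomorphic (S T : topologicalType) : Prop :=
  exists (h : S -> T) (g : T -> S),
    [/\ cancel h g, cancel g h, continuous h & continuous g].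

Definition polish_space (R : realType) (Y : topologicalType) : Prop :=
  separable_space Y /\
  exists M : metricType R, complete_metric M /\ homeomorphic M Y.

Definition souslin_space (R : realType) (X : topologicalType) : Prop :=
  hausdorff_space X /\
  exists Y : topologicalType, polish_space R Y /\
    exists g : Y -> X, continuous g /\ set_surj setT setT g.

(* measurableType structures are pointed, so X is a pointed (that is,
   nonempty) topological space. *)
Notation borel X := (g_sigma_algebraType (@open X)).

(* R[i] carries the metric topology of its modulus through the alias R[i]^o. *)
Definition Cb (R : realType) (X : topologicalType) : set (X -> R[i]) :=
  [set f | continuous (f : X -> R[i]^o) /\ bounded_fun (f : X -> R[i]^o)].

Definition measuresF (R : realType) (X : ptopologicalType)
    (F : set (X -> R[i])) : set {measure set (borel X) -> \bar R} :=
  [set mu | forall f, F f ->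
     (\int[mu]_(x in [set: borel X]) (Normc.normc (f x))%:E < +oo)%E].

Definition complex_integral (R : realType) (d : measure_display)
    (T : measurableType d) (mu : {measure set T -> \bar R})
    (f : T -> R[i]) : R[i] :=
  Rintegral mu setT (fun x => complex.Re (f x)) +i*
  Rintegral mu setT (fun x => complex.Im (f x)).

Definition mul_closed (R : realType) (X : Type) (F : set (X -> R[i])) : Prop :=
  forall f g, F f -> F g -> F (fun x => f x * g x).

Definition conj_closed (R : realType) (X : Type) (F : set (X -> R[i])) : Prop :=
  forall f, F f -> F (fun x => (f x)^*).

Definition separates_points (R : realType) (X : Type)
    (F : set (X -> R[i])) : Prop :=
  forall x y, x <> y -> exists2 f, F f & f x <> f y.

Definition vanishes_nowhere (R : realType) (X : Type)
    (F : set (X -> R[i])) : Prop :=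
  forall x, exists2 f, F f & f x <> 0.

(* A library measure is a function on all subsets that is only constrained on
   measurable ones, so equality of measures is equality on Borel sets. *)
Definition separating_for (R : realType) (X : ptopologicalType)
    (F : set (X -> R[i])) (M : set {measure set (borel X) -> \bar R}) : Prop :=
  forall mu1 mu2, M mu1 -> M mu2 ->
    (forall f, F f -> complex_integral mu1 f = complex_integral mu2 f) ->
    forall A : set (borel X), measurable A -> mu1 A = mu2 A.

(* Main.v *)
(* The real and imaginary parts of the functions in F form a class S in which
   every product is a linear combination of two members.  Call a bounded
   measurable v balanced if v s has the same integral under both measures for
   all s in S, and u a multiplier if u v is balanced for all balanced v.
   Multipliers form an algebra that contains S and is closed under bounded
   pointwise limits, so the sets with multiplier indicators form a
   sigma-algebra for which S is measurable.  Since S separates points, the Lusin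
   separation argument in a Polish space above X, applied to an open set and its
   complement, shows that this sigma-algebra contains all Borel sets.  For
   0 <= w in S the multipliers 1_A (1 + (1 - w) + ... + (1 - w)^(n-1)), times w,
   increase to the indicator of A `&` {w != 0} (after scaling w below 1), so the
   measures agree inside {w != 0}; countably many of these open sets cover X by
   the Lindelof property. *)
Require Import Defs.
From mathcomp Require Import all_boot all_order all_algebra.
From mathcomp Require Import complex.
From mathcomp Require Import ring lra.
From mathcomp Require Import all_classical all_reals all_analysis.
From mathcomp Require Import measurable_realfun.

Local Open Scope classical_set_scope.

Set Implicit Arguments.
Unset Strict Implicit.
Unset Printing Implicit Defensive.

Import Order.TTheory GRing.Theory Num.Theory.
Import numFieldNormedType.Exports.

Local Open Scope ring_scope.

(** * Separation of images by members of a sigma-algebra *)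

Section lusin_separation.
Context (R : realType) (X : Type) (Sg : set (set X)).
Hypothesis Sg_sigma : sigma_algebra setT Sg.

Let SgC A : Sg A -> Sg (~` A).
Proof. by rewrite -setTD; case: Sg_sigma => _ + _; exact. Qed.

Let Sg_bigcup A : (forall i : nat, Sg (A i)) -> Sg (\bigcup_i A i).
Proof. by case: Sg_sigma => _ _; exact. Qed.

Let Sg_bigcap A : (forall i : nat, Sg (A i)) -> Sg (\bigcap_i A i).
Proof.
move=> SA; rewrite -[X in Sg X]setCK setC_bigcap; apply: SgC.
by apply: Sg_bigcup => i; exact: SgC.
Qed.

Definition separated_by (A B : set X) :=
  exists2 C, Sg C & A `<=` C /\ B `<=` ~` C.

Lemma separated_by_sub A B A' B' :
  A' `<=` A -> B' `<=` B -> separated_by A B -> separated_by A' B'.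
Proof.
move=> AA BB [C SC [AC BC]]; exists C => //.
by split; [exact: subset_trans AC|exact: subset_trans BC].
Qed.

(** If [C n m] separates [A n] from [B m], then its intersection over [m] still contains [A n] and
    avoids every [B m]; the union over [n] keeps both properties. *)
Lemma separated_by_bigcup (A B : nat -> set X) :
  (forall n m, separated_by (A n) (B m)) ->
  separated_by (\bigcup_n A n) (\bigcup_m B m).
Proof.
move=> /(_ _ _)/cid2 AB; pose C n m := sval (AB n m).
have CP n m : [/\ Sg (C n m), A n `<=` C n m & B m `<=` ~` C n m].
  by rewrite /C; case: (AB n m) => /= D ? [? ?].
exists (\bigcup_n \bigcap_m C n m).
  by apply: Sg_bigcup => n; apply: Sg_bigcap => m; case: (CP n m).
split=> [x [n _ Anx]|x [m _ Bmx] [n _ /(_ m I)]].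
  by exists n => // m _; have [_ + _] := CP n m; exact.
by have [_ _ BC] := CP n m; exact: BC.
Qed.

Lemma separated_by0l B : separated_by set0 B.
Proof.
exists set0; first by case: Sg_sigma.
by split => // x _ [].
Qed.

Lemma separated_by0r A : separated_by A set0.
Proof.
exists (~` set0); first by apply: SgC; case: Sg_sigma.
by split => // x _ [].
Qed.

Context (M : metricType R) (d : nat -> M) (g : M -> X).
Hypothesis d_dense : forall y (e : R), 0 < e -> exists k, ball (d k) e y.
Hypothesis M_complete : complete_metric M.

Definition locally_separated (a b : M) := exists e : R,
  0 < e /\ separated_by (g @` ball a e) (g @` ball b e).

Let cell n k : set M := ball (d k) (n.+1%:R^-1 : R).

Let cell_cover n A : A = \bigcup_k (A `&` cell n k).
Proof.
rewrite -setI_bigcupr; apply/esym/setIidPl => y _.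
by have [|k dky] := @d_dense y (n.+1%:R^-1); [rewrite invr_gt0|exists k].
Qed.

(** Contrapositive of [separated_by_bigcup]. The indices precede the implication so that [choice]
    can select them for every [P], separable or not. *)
Let refine n (P : set M * set M) : exists kl : nat * nat,
  ~ separated_by (g @` P.1) (g @` P.2) ->
  ~ separated_by (g @` (P.1 `&` cell n kl.1)) (g @` (P.2 `&` cell n kl.2)).
Proof.
apply: contrapT => nkl.
have sepP k l :
    separated_by (g @` (P.1 `&` cell n k)) (g @` (P.2 `&` cell n l)).
  by apply: contrapT => nsep; apply: nkl; exists (k, l).
(* Any indices serve: the images of [P] turn out to be separable. *)
apply: nkl; exists (0, 0)%N; apply: contra_notP => _.
rewrite (cell_cover n P.1) (cell_cover n P.2) !image_bigcup.
exact: separated_by_bigcup.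
Qed.

(* If the images are inseparable, then so are those of two nested sequences of
   cells with vanishing radii, and local separation fails at their limits. *)
Lemma lusin_separation (S1 S2 : set M) :
  (forall a b, closure S1 a -> closure S2 b -> locally_separated a b) ->
  separated_by (g @` S1) (g @` S2).
Proof.
move=> loc; apply: contrapT => nsep.
have /choice[c cP] : forall nP : nat * (set M * set M), exists kl : nat * nat,
  ~ separated_by (g @` nP.2.1) (g @` nP.2.2) ->
  ~ separated_by (g @` (nP.2.1 `&` cell nP.1 kl.1))
      (g @` (nP.2.2 `&` cell nP.1 kl.2)).
  by move=> [n P]; exact: refine.
(* Membership in the chosen [cell m] is imposed from stage [m.+1] on, hence the strict inequality in
   [lim_of]. *)
pose fix P (n : nat) : set M * set M := if n is m.+1 then
  ((P m).1 `&` cell m (c (m, P m)).1, (P m).2 `&` cell m (c (m, P m)).2)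
  else (S1, S2).
have nsepP n : ~ separated_by (g @` (P n).1) (g @` (P n).2).
  by elim: n => //= n IH; exact: (cP (n, P n) IH).
have P1le n m : (n <= m)%N -> (P m).1 `<=` (P n).1.
  elim: m => [|m IH]; first by rewrite leqn0 => /eqP ->.
  rewrite leq_eqVlt ltnS => /predU1P[-> //|/IH]; apply: subset_trans.
  by move=> x [].
have P2le n m : (n <= m)%N -> (P m).2 `<=` (P n).2.
  elim: m => [|m IH]; first by rewrite leqn0 => /eqP ->.
  rewrite leq_eqVlt ltnS => /predU1P[-> //|/IH]; apply: subset_trans.
  by move=> x [].
(* The empty set is separated from everything, so inseparable sets are nonempty. *)
have /choice[a aP] n : exists a, (P n).1 a.
  apply/set0P/eqP => P0; apply: (nsepP n); rewrite P0 image_set0.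
  exact: separated_by0l.
have /choice[b bP] n : exists b, (P n).2 b.
  apply/set0P/eqP => P0; apply: (nsepP n); rewrite P0 image_set0.
  exact: separated_by0r.
have lim_of (u : nat -> M) (k : nat -> nat) :
    (forall n m, (n < m)%N -> cell n (k n) (u m)) ->
    exists2 l : M, u @ \oo --> l & forall e : R, 0 < e ->
      exists n, cell n (k n) `<=` ball l e.
  move=> uk; have small (e : R) : 0 < e ->
      \forall n \near \oo, (n.+1%:R^-1 : R) < e.
    move=> /(cvgr0_norm_lt _ (@cvg_harmonic R)); apply: filterS => n.
    by rewrite ger0_norm// invr_ge0.
  have [l ul] : exists l : M, u @ \oo --> l.
    apply/M_complete/cauchy_exP => e e0.
    have [n _ nP] := small e e0; exists (d (k n)); exists n.+1 => //= m nm.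
    by apply: le_ball (uk _ _ nm); exact/ltW/nP/leqnn.
  exists l => // e e0.
  (* One third each: from [l] to a late [u m], from there to the center of the cell, from the center
     to [y]. *)
  have e3 : 0 < e / 3 by rewrite divr_gt0.
  have /cvg_ball/(_ _ e3)[N _ uN] := ul.
  have [n _ nP] := small _ e3; exists n.
  have ne : (n.+1%:R^-1 : R) < e / 3 by apply: nP => /=.
  move=> y dy; pose m := maxn N n.+1.
  have lm : ball l (e / 3) (u m) by apply: uN => /=; exact: leq_maxl.
  have dm : ball (d (k n)) (e / 3) (u m).
    by apply: le_ball (uk n m _); [exact: ltW|exact: leq_maxr].
  have -> : e = e / 3 + e / 3 + e / 3 by field.
  apply: (@ball_triangle _ _ (d (k n))); last exact: le_ball (ltW ne) _ dy.
  by apply: ball_triangle lm _; exact: ball_sym.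
have [|la ala aball] := lim_of a (fun n => (c (n, P n)).1).
  by move=> n m nm; have [] := P1le _ _ nm _ (aP m).
have [|lb blb bball] := lim_of b (fun n => (c (n, P n)).2).
  by move=> n m nm; have [] := P2le _ _ nm _ (bP m).
have [||e [e0 sepe]] := @loc la lb.
- apply: (closed_cvg _ (@closed_closure _ S1) _ la ala); apply: nearW => n.
  by apply: subset_closure; exact: (P1le 0%N n _ _ (aP n)).
- apply: (closed_cvg _ (@closed_closure _ S2) _ lb blb); apply: nearW => n.
  by apply: subset_closure; exact: (P2le 0%N n _ _ (bP n)).
have [n nP] := aball e e0; have [m mP] := bball e e0.
(* At this stage both sets lie in the small cells, hence in the two balls whose images are
   separated. *)
apply: (nsepP (maxn n m).+1); apply: separated_by_sub sepe; apply: image_subset.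
- have nm : (n.+1 <= (maxn n m).+1)%N by rewrite ltnS leq_maxl.
  by move=> x /(P1le _ _ nm)[_ /nP].
- have nm : (m.+1 <= (maxn n m).+1)%N by rewrite ltnS leq_maxr.
  by move=> x /(P2le _ _ nm)[_ /mP].
Qed.

End lusin_separation.

(** * Polynomial approximation of the absolute value *)

Section sqrt_iteration.
Context {R : realType}.
Implicit Type x : R.

(** Iteration for the square root of [x * x]. Each term is a polynomial in [x], so an algebra closed
    under bounded limits contains absolute values. *)
Fixpoint norm_approx (n : nat) (x : R) : R :=
  if n is m.+1 then
    norm_approx m x + (x * x - norm_approx m x * norm_approx m x) / 2
  else 0.

(** Consecutive terms p, p' satisfy |x| - p' = (|x| - p) (1 - (|x| + p) / 2), where the last factor
    lies in [0, 1]. *)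
Lemma norm_approx_itv n x : `|x| <= 1 -> 0 <= norm_approx n x <= `|x|.
Proof.
move=> x1; have x0 := normr_ge0 x; elim: n => [|n /andP[p0 px]] /=.
  by rewrite lexx.
have -> : x * x = `|x| * `|x| by rewrite -!expr2 real_normK// num_real.
by apply/andP; split; nra.
Qed.

Lemma norm_approx_nd x : `|x| <= 1 ->
  nondecreasing_seq (norm_approx ^~ x).
Proof.
move=> x1; apply/nondecreasing_seqP => n /=.
have /andP[p0 px] := norm_approx_itv n x1.
have -> : x * x = `|x| * `|x| by rewrite -!expr2 real_normK// num_real.
by nra.
Qed.

(** The monotone limit [l] is a fixed point of the recursion, so its square is that of [x], and it
    is nonnegative. *)
Lemma cvg_norm_approx x : `|x| <= 1 -> norm_approx ^~ x @ \oo --> `|x|.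
Proof.
move=> x1; have pb n := norm_approx_itv n x1.
have cp : cvgn (norm_approx ^~ x).
  apply: nondecreasing_is_cvgn; first exact: norm_approx_nd.
  by exists `|x| => _ [n _ <-]; have /andP[] := pb n.
set l := limn (norm_approx ^~ x).
suff <- : l = `|x| by [].
have l0 : 0 <= l.
  by apply: limr_ge => //; apply: nearW => n; have /andP[] := pb n.
have : [sequence norm_approx n.+1 x]_n @ \oo --> l.
  by rewrite (cvg_shiftS (norm_approx ^~ x)).
have : norm_approx n.+1 x @[n --> \oo] --> l + (x * x - l * l) / 2.
  apply: cvgD => //; apply: cvgMl; apply: cvgB; first exact: cvg_cst.
  exact: cvgM.
move=> cl /(cvg_unique _ cl)-/(_ (@norm_hausdorff _ _))/eqP.
rewrite eq_sym addrC -subr_eq subrr eq_sym.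
rewrite mulf_eq0 invr_eq0 pnatr_eq0 orbF subr_eq0 -!expr2 => /eqP xl.
by rewrite -sqrtr_sqr xl sqrtr_sqr ger0_norm.
Qed.

End sqrt_iteration.

(** * The algebra of multipliers *)

Section separating_class.
Context d (T : measurableType d) (R : realType).
Context (mu1 mu2 : {measure set T -> \bar R}) (S : set (T -> R)).

Definition bounded_measurable (u : T -> R) :=
  measurable_fun setT u /\ exists M, forall x, `|u x| <= M.

Hypothesis S_bm : forall s, S s -> bounded_measurable s.
Hypothesis S_int : forall s, S s ->
  mu1.-integrable setT (EFin \o s) /\ mu2.-integrable setT (EFin \o s).
Hypothesis S_eq : forall s, S s ->
  (\int[mu1]_x (s x)%:E = \int[mu2]_x (s x)%:E)%E.
Hypothesis S_mul : forall s t, S s -> S t -> exists s1 s2 a b,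
  [/\ S s1, S s2 & forall x, s x * t x = a * s1 x + b * s2 x].

Lemma bounded_measurableD u v : bounded_measurable u -> bounded_measurable v ->
  bounded_measurable (fun x => u x + v x).
Proof.
move=> [mu [M uM]] [mv [N vN]]; split; first exact: measurable_funD.
exists (M + N) => x; exact: le_trans (ler_normD _ _) (lerD _ _).
Qed.

Lemma bounded_measurableM u v : bounded_measurable u -> bounded_measurable v ->
  bounded_measurable (fun x => u x * v x).
Proof.
move=> [mu [M uM]] [mv [N vN]]; split; first exact: measurable_funM.
by exists (M * N) => x; rewrite normrM ler_pM.
Qed.

Lemma bounded_measurable_cst (c : R) : bounded_measurable (fun=> c).
Proof. by split; [exact: measurable_cst|exists `|c|]. Qed.

Lemma bounded_measurable_lim (u : nat -> T -> R) (l : T -> R) (M : R) :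
  (forall n, bounded_measurable (u n)) -> (forall n x, `|u n x| <= M) ->
  (forall x, u ^~ x @ \oo --> l x) -> bounded_measurable l.
Proof.
move=> bmu uM ul; split.
  by apply: (@measurable_fun_cvg _ _ _ _ u) => [n|x _];
    [case: (bmu n)|exact: ul].
exists M => x; have ulx : `|u n x| @[n --> \oo] --> `|l x| by apply: cvg_norm.
by rewrite -(cvg_lim _ ulx)//; apply: limr_le; [exact: cvgP ulx|exact: nearW].
Qed.

Lemma integrable_bounded_measurableM (mu : {measure set T -> \bar R}) u s :
  bounded_measurable u -> mu.-integrable setT (EFin \o s) ->
  mu.-integrable setT (fun x => (u x * s x)%:E).
Proof.
move=> [mu_ [M uM]] si.
have ms : measurable_fun setT s by apply/measurable_EFinP; case/integrableP: si.
apply: (@le_integrable _ _ _ mu setT measurableT _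
  (fun x => M%:E * (s x)%:E)%E).
- by apply/measurable_EFinP; exact: measurable_funM.
- move=> x _; rewrite -EFinM !abse_EFin lee_fin !normrM ler_wpM2r//.
  exact: le_trans (uM x) (ler_norm _).
- exact: integrableZl.
Qed.

(** The measures may be infinite, so [u] alone need not be integrable; its product with a member of
    [S] is. *)
Definition balanced u := bounded_measurable u /\
  forall s, S s ->
    (\int[mu1]_x (u x * s x)%:E = \int[mu2]_x (u x * s x)%:E)%E.

(** Balanced functions form a vector space with no evident products; the functions that preserve
    this space under multiplication form an algebra. *)
Definition multiplier u := bounded_measurable u /\
  forall v, balanced v -> balanced (fun x => u x * v x).

Lemma balancedD u v : balanced u -> balanced v ->
  balanced (fun x => u x + v x).
Proof.
move=> [bu ue] [bv ve]; split; first exact: bounded_measurableD.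
move=> s Ss; have [s1 s2] := S_int Ss.
under eq_integral do rewrite mulrDl.
under [RHS]eq_integral do rewrite mulrDl.
by rewrite !integralD_EFin ?ue ?ve//; exact: integrable_bounded_measurableM.
Qed.

Lemma balancedZ c u : balanced u ->
  balanced (fun x => c * u x).
Proof.
move=> [bu ue]; split.
  by apply: bounded_measurableM => //; exact: bounded_measurable_cst.
move=> s Ss; have [s1 s2] := S_int Ss.
under eq_integral do rewrite -mulrA EFinM.
under [RHS]eq_integral do rewrite -mulrA EFinM.
by rewrite !integralZl ?ue//; exact: integrable_bounded_measurableM.
Qed.

(** Dominated convergence, with dominating function M |s|. *)
Lemma balanced_lim (u : nat -> T -> R) (l : T -> R) (M : R) :
  (forall n, balanced (u n)) -> (forall n x, `|u n x| <= M) ->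
  (forall x, u ^~ x @ \oo --> l x) -> balanced l.
Proof.
move=> ue uM ul.
have bl : bounded_measurable l.
  by apply: bounded_measurable_lim uM ul => n; case: (ue n).
split=> // s Ss; have [s1 s2] := S_int Ss; have [ms _] := S_bm Ss.
have cvg_int (mu : {measure set T -> \bar R}) :
    mu.-integrable setT (EFin \o s) ->
    (\int[mu]_x (u n x * s x)%:E)%E @[n --> \oo] -->
    (\int[mu]_x (l x * s x)%:E)%E.
  move=> si.
  apply: (@dominated_cvg _ _ _ mu setT measurableT
    (fun n x => (u n x * s x)%:E) (fun x => (l x * s x)%:E)
    (fun x => M%:E * `|(s x)%:E|)%E) => //.
  - move=> n; apply/measurable_EFinP/measurable_funM => //.
    by case: (ue n) => -[].
  - by move=> x _; apply: cvg_EFin; [exact: nearW|apply: cvgMl; exact: ul].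
  - exact/integrableZl/integrable_abse.
  - move=> n x _; rewrite !abse_EFin -EFinM lee_fin normrM.
    by rewrite ler_wpM2r.
have := cvg_int _ s1; under eq_fun do rewrite (proj2 (ue _) _ Ss).
by move/cvg_unique => /(_ _ _ (cvg_int _ s2)); apply.
Qed.

Lemma balanced_cst c : balanced (fun=> c).
Proof.
split; first exact: bounded_measurable_cst.
move=> s Ss; have [s1 s2] := S_int Ss.
under eq_integral do rewrite EFinM.
under [RHS]eq_integral do rewrite EFinM.
by rewrite !integralZl// S_eq.
Qed.

Lemma multiplier_balanced u : multiplier u -> balanced u.
Proof.
move=> [_ /(_ _ (balanced_cst 1))]; congr balanced.
by apply/funext => x; rewrite mulr1.
Qed.

Lemma multiplierD u v : multiplier u -> multiplier v ->
  multiplier (fun x => u x + v x).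
Proof.
move=> [bu um] [bv vm]; split; first exact: bounded_measurableD.
move=> w we; rewrite (_ : (fun x => _) = (fun x => u x * w x + v x * w x)).
  by apply: balancedD; [exact: um|exact: vm].
by apply/funext => x; rewrite mulrDl.
Qed.

Lemma multiplierM u v : multiplier u -> multiplier v ->
  multiplier (fun x => u x * v x).
Proof.
move=> [bu um] [bv vm]; split; first exact: bounded_measurableM.
move=> w we; rewrite (_ : (fun x => _) = (fun x => u x * (v x * w x))).
  by apply: um; exact: vm.
by apply/funext => x; rewrite mulrA.
Qed.

Lemma multiplier_cst c : multiplier (fun=> c).
Proof.
split; first exact: bounded_measurable_cst.
by move=> v ve; exact: balancedZ.
Qed.

Lemma multiplier_lim (u : nat -> T -> R) (l : T -> R) (M : R) :
  (forall n, multiplier (u n)) -> (forall n x, `|u n x| <= M) ->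
  (forall x, u ^~ x @ \oo --> l x) -> multiplier l.
Proof.
move=> um uM ul; split.
  by apply: bounded_measurable_lim uM ul => n; case: (um n).
move=> v ve; have [[_ [N vN]] _] := ve.
apply: (@balanced_lim (fun n x => u n x * v x) _ (M * N)).
- by move=> n; exact: (proj2 (um n)).
- by move=> n x; rewrite normrM ler_pM.
- by move=> x; apply: cvgMl; exact: ul.
Qed.

(** Regroup s v t as v (s t): [S_mul] writes s t as a combination of members of [S], against which
    [v] is balanced. *)
Lemma multiplier_mem s : S s -> multiplier s.
Proof.
move=> Ss; split; first exact: S_bm.
move=> v [bv ve]; split.
  by apply: bounded_measurableM => //; exact: S_bm.
move=> t St; have [t1 [t2 [a [b [St1 St2 st]]]]] := S_mul Ss St.
have e x : (s x * v x * t x)%:E =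
    (a%:E * (v x * t1 x)%:E + b%:E * (v x * t2 x)%:E)%E.
  rewrite -!EFinM -EFinD; congr EFin.
  by rewrite mulrAC st; ring.
under eq_integral do rewrite e.
under [RHS]eq_integral do rewrite e.
have [i11 i12] := S_int St1; have [i21 i22] := S_int St2.
rewrite !integralD//; try by apply: integrableZl => //;
  exact: integrable_bounded_measurableM.
by rewrite !integralZl ?ve//; exact: integrable_bounded_measurableM.
Qed.

Lemma multiplierN u : multiplier u -> multiplier (fun x => - u x).
Proof.
move=> um; rewrite (_ : (fun x => _) = (fun x => -1 * u x)).
  by apply: multiplierM => //; exact: multiplier_cst.
by apply/funext => x; rewrite mulN1r.
Qed.

Lemma multiplierX u n : multiplier u -> multiplier (fun x => u x ^+ n).
Proof.
move=> um; elim: n => [|n IH].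
  by under eq_fun do rewrite expr0; exact: multiplier_cst.
by under eq_fun do rewrite exprS; exact: multiplierM.
Qed.

(** After scaling into [-1, 1], the absolute value is a bounded pointwise limit of polynomials in
    the function. *)
Lemma multiplier_norm u : multiplier u -> multiplier (fun x => `|u x|).
Proof.
move=> um; have [[_ [M uM]] _] := um.
(* The bound [M] may be 0; this one is positive and can be divided by. *)
have M1 : 0 < `|M| + 1 by rewrite ltr_wpDl.
pose v x := (`|M| + 1)^-1 * u x.
have vm : multiplier v by apply: multiplierM => //; exact: multiplier_cst.
have v1 x : `|v x| <= 1.
  rewrite normrM normfV [X in X^-1]gtr0_norm// mulrC ler_pdivrMr// mul1r.
  by rewrite (le_trans (uM x))// (le_trans (ler_norm _))// lerDl.
rewrite (_ : (fun x => _) = (fun x => (`|M| + 1) * `|v x|)); last first.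
  apply/funext => x; rewrite normrM normfV [X in X^-1]gtr0_norm//.
  by rewrite mulrA divff ?mul1r// gt_eqF.
apply: multiplierM; first exact: multiplier_cst.
apply: (@multiplier_lim (fun n x => norm_approx n (v x)) _ 1).
- elim=> [|n IH] /=; first exact: multiplier_cst.
  apply: multiplierD => //; apply: multiplierM; last exact: multiplier_cst.
  by apply: multiplierD; [exact: multiplierM|exact/multiplierN/multiplierM].
- move=> n x; have /andP[p0 pv] := norm_approx_itv n (v1 x).
  by rewrite ger0_norm// (le_trans pv).
- by move=> x; exact: cvg_norm_approx.
Qed.

Lemma indic_setE (b : T -> bool) x : \1_[set y | b y] x = (b x)%:R :> R.
Proof.
rewrite indicE; have [bx|/negP bx] := boolP (b x); first by rewrite mem_set.
by rewrite memNset.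
Qed.

Definition multiplier_set (A : set T) := multiplier (\1_A : T -> R).

Lemma cvg_onem_expr (t : R) : 0 <= t <= 1 ->
  1 - (1 - t) ^+ n @[n --> \oo] --> ((t != 0)%:R : R).
Proof.
move=> /andP[t0 t1]; have [->|tn0] := eqVneq t 0.
  by under eq_fun do rewrite subr0 expr1n subrr; exact: cvg_cst.
rewrite -[X in _ --> X]subr0; apply: cvgB; first exact: cvg_cst.
by apply: cvg_expr; rewrite ger0_norm ?subr_ge0// ltrBlDr ltrDl lt_def tn0.
Qed.

Lemma onem_expr_itv (t : R) n : 0 <= t <= 1 -> 0 <= 1 - (1 - t) ^+ n <= 1.
Proof.
move=> /andP[t0 t1]; rewrite subr_ge0 exprn_ile1 ?subr_ge0 ?lerBlDr ?lerDl//=.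
by rewrite exprn_ge0// subr_ge0.
Qed.

(** For v = c |u| with values in [0, 1], the powers of 1 - v tend to 0 where [u] is nonzero and
    equal 1 elsewhere. *)
Lemma multiplier_set_support u : multiplier u ->
  multiplier_set [set x | u x != 0].
Proof.
move=> um; have [[_ [M uM]] _] := um.
have M1 : 0 < `|M| + 1 by rewrite ltr_wpDl.
pose v x := (`|M| + 1)^-1 * `|u x|.
have vm : multiplier v.
  by apply: multiplierM; [exact: multiplier_cst|exact: multiplier_norm].
have v1 x : 0 <= v x <= 1.
  rewrite mulr_ge0 ?invr_ge0 ?(ltW M1)//= /v mulrC ler_pdivrMr// mul1r.
  by rewrite (le_trans (uM x))// (le_trans (ler_norm _))// lerDl.
apply: (@multiplier_lim (fun n x => 1 - (1 - v x) ^+ n) _ 1).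
- move=> n; apply: multiplierD; first exact: multiplier_cst.
  apply/multiplierN/multiplierX/multiplierD; first exact: multiplier_cst.
  exact: multiplierN.
- move=> n x; have /andP[p0 p1] := onem_expr_itv n (v1 x).
  by rewrite ger0_norm.
- move=> x; have := cvg_onem_expr (v1 x).
  by rewrite mulf_eq0 invr_eq0 gt_eqF// normr_eq0 indic_setE.
Qed.

(** A real t is positive exactly when t + |t| is nonzero, so a superlevel set is a support. *)
Lemma multiplier_set_gt u a : multiplier u ->
  multiplier_set [set x | a < u x].
Proof.
move=> um.
have um' : multiplier (fun x => u x - a).
  by apply: multiplierD => //; exact: multiplier_cst.
rewrite (_ : [set x | _] = [set x | (u x - a) + `|u x - a| != 0]).
  by apply: multiplier_set_support; apply: multiplierD => //;
    exact: multiplier_norm.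
apply/seteqP; split=> x /=; rewrite -subr_gt0.
  by move=> ua; rewrite gtr0_norm// gt_eqF// addr_gt0.
by have [//|ua] := ltP 0 (u x - a); rewrite ler0_norm// subrr eqxx.
Qed.

(** Complements come from 1 minus an indicator, intersections from products, countable unions from
    limits of finite unions. *)
Lemma sigma_algebra_multiplier_set : sigma_algebra setT multiplier_set.
Proof.
have mC A : multiplier_set A -> multiplier_set (~` A).
  move=> mA; rewrite /multiplier_set.
  rewrite (_ : \1_(~` A) = (fun x => 1 + - \1_A x :> R)).
    by apply: multiplierD; [exact: multiplier_cst|exact: multiplierN].
  apply/funext => x; rewrite !indicE in_setC.
  by case: (x \in A); rewrite ?subrr ?subr0.
have mI A B : multiplier_set A -> multiplier_set B -> multiplier_set (A `&` B).
  move=> mA mB; rewrite /multiplier_set.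
  by rewrite (_ : \1_(A `&` B) = (fun x => \1_A x * \1_B x :> R));
    [exact: multiplierM|rewrite indicI].
have m0 : multiplier_set set0.
  by rewrite /multiplier_set indic0; exact: multiplier_cst.
split=> // [A|A mA]; first by rewrite setTD; exact: mC.
pose B n := \bigcup_(i < n) A i.
have mB n : multiplier_set (B n).
  elim: n => [|n IH]; first by rewrite /B bigcup_mkord big_ord0.
  rewrite /B bigcup_mkord big_ord_recr/= -bigcup_mkord -/(B n).
  by rewrite -[_ `|` _]setCK setCU; apply/mC/mI; exact: mC.
apply: (@multiplier_lim (fun n => \1_(B n)) _ 1) => // [n x|x].
  by rewrite indicE; case: (_ \in _); rewrite ?normr1 ?normr0.
(* [B n] collects the indices below [n], so the indicators at [x] are constant from [i.+1] on. *)
apply: cvg_near_cst; have [[i _ Aix]|nA] := pselect ((\bigcup_n A n) x).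
  exists i.+1 => // n /= iln; rewrite !indicE !mem_set//; last by exists i.
  by exists i.
apply: nearW => n; rewrite !indicE !memNset// => -[i _ Aix].
by apply: nA; exists i.
Qed.

Lemma eq_measure_multiplier_set A w : multiplier_set A -> S w ->
  (forall x, 0 <= w x) ->
  mu1 (A `&` [set x | w x != 0]) = mu2 (A `&` [set x | w x != 0]).
Proof.
move=> mA Sw w0; have wm := multiplier_mem Sw.
have [[_ [M wM]] _] := wm.
have M1 : 0 < `|M| + 1 by rewrite ltr_wpDl.
pose c := (`|M| + 1)^-1.
have c0 : 0 < c by rewrite invr_gt0.
have w01 x : 0 <= c * w x <= 1.
  rewrite mulr_ge0 ?(ltW c0)//= mulrC ler_pdivrMr// mul1r.
  rewrite (le_trans (ler_norm _))// (le_trans (wM x))//.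
  by rewrite (le_trans (ler_norm _))// lerDl.
have um : multiplier (fun x => 1 + - (c * w x)).
  apply: multiplierD; first exact: multiplier_cst.
  by apply/multiplierN/multiplierM => //; exact: multiplier_cst.
(* [q] is [c] times a geometric sum in 1 - c w. Factoring out [w] turns the integral of [p n] below
   into a test against a member of [S]. *)
have q n : exists2 q, multiplier q &
    forall x, q x * w x = 1 - (1 - c * w x) ^+ n.
  elim: n => [|n [q qm qw]].
    exists (fun=> 0); first exact: multiplier_cst.
    by move=> x; rewrite mul0r expr0 subrr.
  exists (fun x => c + (1 - c * w x) * q x).
    by apply: multiplierD; [exact: multiplier_cst|exact: multiplierM].
  by move=> x; rewrite mulrDl -mulrA qw exprS; ring.
pose p n x : R := \1_A x * (1 - (1 - c * w x) ^+ n).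
have pm n : multiplier (p n).
  apply: multiplierM => //; apply: multiplierD; first exact: multiplier_cst.
  exact/multiplierN/multiplierX.
have eq_p n : (\int[mu1]_x (p n x)%:E = \int[mu2]_x (p n x)%:E)%E.
  have [r rm rw] := q n.
  have [_ /(_ _ Sw)] := multiplier_balanced (multiplierM mA rm).
  by under eq_integral do rewrite -mulrA rw; under [RHS]eq_integral do
    rewrite -mulrA rw.
(* Measurability is read off from the indicator, since multipliers are measurable by definition. *)
have mAw : measurable (A `&` [set x | w x != 0]).
  apply/(measurable_indicP R).
  suff [[]] : multiplier_set (A `&` [set x | w x != 0]) by [].
  rewrite /multiplier_set indicI; apply: multiplierM => //.
  exact: multiplier_set_support.
have cvg_p x : (p n x)%:E @[n --> \oo] --> (\1_(A `&` [set x | w x != 0]) x)%:E.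
  apply: cvg_EFin; first exact: nearW.
  rewrite indicI; apply: cvgMr.
  by have := cvg_onem_expr (w01 x); rewrite mulf_eq0 gt_eqF// indic_setE.
(* The limit may be infinite; monotone convergence applies because [p n] increases with [n]. *)
have int_p (mu : {measure set T -> \bar R}) :
    (\int[mu]_x (p n x)%:E)%E @[n --> \oo] --> mu (A `&` [set x | w x != 0]).
  rewrite -[X in mu X]setIT -integral_indic//.
  under eq_integral do rewrite -(cvg_lim _ (cvg_p _))//.
  apply: cvg_monotone_convergence => //.
  - by move=> n; apply/measurable_EFinP; case: (pm n) => -[].
  - move=> n x _; rewrite lee_fin mulr_ge0//.
    by have /andP[] := onem_expr_itv n (w01 x).
  - move=> x _ n m nm; rewrite lee_fin ler_wpM2l// lerB//.
    have /andP[cw0 cw1] := w01 x.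
    by rewrite ler_wiXn2l// ?subr_ge0// lerBlDr lerDl.
have := int_p mu1; under eq_fun do rewrite eq_p.
by move/cvg_unique => /(_ _ _ (int_p mu2)); apply.
Qed.

End separating_class.

(** * Real and imaginary parts *)

Section complex_parts.
Context {R : realType}.
Implicit Type z : R[i].

Lemma normr_Re_le z : `|complex.Re z| <= Normc.normc z.
Proof. by rewrite -lecR; exact: normc_ge_Re. Qed.

Lemma normr_Im_le z : `|complex.Im z| <= Normc.normc z.
Proof.
case: z => a b; rewrite /= -sqrtr_sqr ler_sqrt ?addr_ge0 ?sqr_ge0//.
by rewrite lerDr sqr_ge0.
Qed.

(** Any subtractive [part] bounded by the modulus is 1-Lipschitz; this covers [Re] and [Im] at
    once. *)
Lemma continuous_part (T : topologicalType) (part : R[i] -> R) (f : T -> R[i]) :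
  {morph part : z w / z - w} -> (forall z, `|part z| <= Normc.normc z) ->
  continuous (f : T -> R[i]^o) -> continuous (part \o f).
Proof.
move=> partB part_le cf x; apply/cvgrPdist_lt => e e0.
(* Distances in [R[i]^o] are complex numbers, so the radius is embedded. *)
have e0' : 0 < e%:C%C by rewrite ltcR.
have /cvgrPdist_lt/(_ _ e0') := cf x; apply: filterS => y fxy.
rewrite /= -partB (le_lt_trans (part_le _))// -ltcR.
exact: fxy.
Qed.

Lemma bounded_part (T : Type) (part : R[i] -> R) (f : T -> R[i]) :
  (forall z, `|part z| <= Normc.normc z) -> bounded_fun (f : T -> R[i]^o) ->
  exists M, forall x, `|part (f x)| <= M.
Proof.
(* The bounds given by [bounded_fun] are elements of [R[i]] strictly above [M], hence [M + 1] and
   its real part. *)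
move=> part_le [M [_ /(_ (M + 1))fM]]; exists (complex.Re (M + 1)) => x.
have : (Normc.normc (f x))%:C%C <= M + 1 by apply: fM; rewrite ?ltrDl.
by rewrite lecE => /andP[_]; exact: le_trans.
Qed.

End complex_parts.

(** * Borel functions and parametrization of Souslin spaces *)

Lemma continuous_borel_measurable (R : realType) (X : ptopologicalType)
    (f : X -> R) : continuous f -> measurable_fun [set: borel X] f.
Proof.
move=> cf; apply: (measurability _ (RGenOInfty.measurableE R)).
move=> _ [_ [a ->] <-]; rewrite setTI; apply: sub_sigma_algebra.
by apply: open_comp => // x _; exact: cf.
Qed.

(* The homeomorphism with a complete metric space is absorbed in [g]. *)
Lemma souslin_param (R : realType) (X : ptopologicalType) : souslin_space R X ->
  exists (M : metricType R) (d : nat -> M) (g : M -> X),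
  [/\ complete_metric M, forall y (e : R), 0 < e -> exists k, ball (d k) e y,
      continuous g & forall x, exists y, g y = x].
Proof.
move=> [_ [Y [[[D cD dD] [M [Mc [h [k [hk kh ch ck]]]]]] [g [cg gs]]]]].
have gsurj x : exists y, g y = x by have [//|y _ <-] := gs x; exists y.
have [y0 _] := gsurj point.
have /countable_injP[p pinj] := cD.
(* [d] inverts the numbering [p] of [D]; numbers that are not attained get the default [y0]. *)
have /choice[d dP] (n : nat) : exists y, forall y', D y' -> p y' = n -> y = y'.
  have [[y' [Dy' <-]]|nD] := pselect (exists y', D y' /\ p y' = n).
    exists y' => y Dy pyy'; apply: pinj; rewrite ?inE//.
  by exists y0 => y' Dy' py'; exfalso; apply: nD; exists y'.
exists M, (k \o d), (g \o h); split => //.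
- move=> y e e0.
  have oU : open (k @^-1` (ball y e)°).
    by apply: open_comp => //; exact: open_interior.
  have [|z [yz Dz]] := dD _ _ oU.
    exists (h y); rewrite /= hk.
    exact: nbhs_singleton (nbhs_interior (nbhsx_ballx _ _ e0)).
  exists (p z); apply: ball_sym; rewrite /= (dP _ _ Dz erefl).
  exact: interior_subset yz.
- by move=> x; apply: continuous_comp; [exact: ch|exact: cg].
- by move=> x; have [y <-] := gsurj x; exists (k y); rewrite /= kh.
Qed.

(** * Countable covers and open sets of Souslin spaces *)

Section souslin.
Context (R : realType) (X : ptopologicalType) (M : metricType R).
Context (d : nat -> M) (g : M -> X).
Hypothesis M_complete : complete_metric M.
Hypothesis d_dense : forall y (e : R), 0 < e -> exists k, ball (d k) e y.
Hypothesis g_continuous : continuous g.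
Hypothesis g_surj : forall x, exists y, g y = x.

Let near_radius (P : set M) y : nbhs y P ->
  exists n, ball y (n.+1%:R^-1 : R) `<=` P.
Proof.
move=> /nbhs_ballP[e /= e0 eP].
have [n _ nP] := cvgr0_norm_lt _ (@cvg_harmonic R) _ e0.
exists n => z yz; apply: eP; apply: le_ball yz; apply: ltW.
by apply: le_lt_trans (ler_norm _) (nP n _) => /=.
Qed.

(** For each of the countably many balls with center [d k] and radius 1 / (n + 1), one member of [S]
    without zeros on the image of the ball is chosen, if there is one. *)
Lemma souslin_lindelof (S : set (X -> R)) : S !=set0 ->
  (forall s, S s -> continuous s) -> (forall x, exists2 s, S s & s x != 0) ->
  exists2 w : nat -> X -> R, forall n, S (w n) & forall x, exists n, w n x != 0.
Proof.
move=> [s0 Ss0] Sc Snz.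
have /choice[w wP] (kn : nat * nat) : exists s, S s /\ forall t, S t ->
    (forall y, ball (d kn.1) (kn.2.+1%:R^-1 : R) y -> t (g y) != 0) ->
    (forall y, ball (d kn.1) (kn.2.+1%:R^-1 : R) y -> s (g y) != 0).
  have [[t [St tnz]]|nt] := pselect (exists t, S t /\
      forall y, ball (d kn.1) (kn.2.+1%:R^-1 : R) y -> t (g y) != 0).
    by exists t.
  by exists s0; split=> // t St tnz; exfalso; apply: nt; exists t.
exists (fun i => if unpickle i is Some kn then w kn else s0).
  by move=> i; case: (unpickle i) => // kn; have [] := wP kn.
move=> x; have [y gy] := g_surj x; have [s Ss sx] := Snz x.
have /near_radius[n nP] : nbhs y [set z | s (g z) != 0].
  have : nbhs (s (g y)) [set t | t != 0].
    by apply: open_nbhs_nbhs; split; [exact: open_neq|rewrite /= gy].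
  by move/(continuous_comp (@g_continuous y) (Sc _ Ss (g y))).
(* Half of 1 / (n + 1): a ball of this radius whose center is this close to [y] stays in the ball
   around [y]. *)
have n2 : 0 < ((n.*2).+1.+1%:R^-1 : R) by rewrite invr_gt0.
have [k ky] := d_dense y n2.
exists (pickle (k, n.*2.+1)); rewrite pickleK -gy.
have [_ /(_ _ Ss)] := wP (k, n.*2.+1); apply => //= z kz; apply: nP.
have -> : n.+1%:R^-1 = (n.*2).+2%:R^-1 + (n.*2).+2%:R^-1 :> R.
  have -> : (n.*2).+2 = (2 * n.+1)%N by rewrite mul2n doubleS.
  by rewrite natrM invfM; field; rewrite gt_eqF.
exact: ball_triangle (ball_sym ky) kz.
Qed.

(** A separator of the complement of [U] from [U] can only be that complement, so the Lusin argument
    applied to the preimages in [M] suffices. *)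
Lemma souslin_open_sub (Sg : set (set X)) (S : set (X -> R)) :
  sigma_algebra setT Sg ->
  (forall s, S s -> continuous s) ->
  (forall s a, S s -> Sg [set x | a < s x]) ->
  (forall x y, x <> y -> exists2 s, S s & s x <> s y) ->
  open `<=` Sg.
Proof.
move=> Sg_sigma Sc Sgt Ssep U oU.
have SgC A : Sg A -> Sg (~` A).
  by rewrite -setTD; case: Sg_sigma => _ + _; exact.
have sep_gt a b s (c : R) : S s -> s (g b) < c < s (g a) ->
    exists2 e : R, 0 < e &
      g @` ball a e `<=` [set x | c < s x] /\
      g @` ball b e `<=` ~` [set x | c < s x].
  move=> Ss /andP[bc ca].
  have csg y : continuous_at y (s \o g).
    exact: continuous_comp (@g_continuous y) (Sc _ Ss (g y)).
  have /near_radius[n nP] : nbhs a [set y | c < s (g y)].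
    exact: cvgr_gt (csg a) _ ca.
  have /near_radius[m mP] : nbhs b [set y | s (g y) < c].
    exact: cvgr_lt (csg b) _ bc.
  exists (Num.min n.+1%:R^-1 m.+1%:R^-1).
    by rewrite lt_min !invr_gt0 !ltr0n.
  split=> _ [y aby <-] /=.
    by apply: nP; apply: le_ball aby; rewrite ge_min lexx.
  apply/negP; rewrite -leNgt ltW//.
  by apply: mP; apply: le_ball aby; rewrite ge_min lexx orbT.
have loc a b : g a <> g b -> locally_separated Sg g a b.
  move=> /Ssep[s Ss /eqP]; rewrite neq_lt => /orP[] slt.
  - have [|e e0 [be ae]] := @sep_gt b a s ((s (g a) + s (g b)) / 2) Ss.
      by rewrite !midf_lt.
    exists e; split => //; exists (~` [set x | (s (g a) + s (g b)) / 2 < s x]).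
      exact/SgC/Sgt.
    by rewrite setCK.
  - have [|e e0 [ae be]] := @sep_gt a b s ((s (g b) + s (g a)) / 2) Ss.
      by rewrite !midf_lt.
    exists e; split => //; exists [set x | (s (g b) + s (g a)) / 2 < s x] => //.
    exact: Sgt.
(* The closure of the preimage of [U] may meet that of the complement, where local separation fails.
   The sets [T n] exhaust this preimage and have closures inside it. *)
pose T n := [set y | ball y (n.+1%:R^-1 : R) `<=` g @^-1` U].
have oV : open (g @^-1` U) by apply: open_comp => // y _; exact: g_continuous.
have sepT (n m : nat) : separated_by Sg (g @` (g @^-1` (~` U))) (g @` T m).
  apply: (lusin_separation Sg_sigma d_dense M_complete) => a b aU bT.
  apply: loc => gab.
  have nUa : ~ U (g a).
    by move: aU; rewrite preimage_setC -(closure_id _).1//; exact: open_closedC.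
  apply: nUa; rewrite gab.
  have m0 : 0 < (m.+1%:R^-1 : R) by rewrite invr_gt0.
  have [y [yT bym]] := bT _ (nbhsx_ballx b _ m0).
  exact/yT/ball_sym.
(* The complement of [U] enters as the union of a constant sequence. *)
have [C SC [UC CU]] := @separated_by_bigcup _ _ Sg_sigma (fun=> _) _ sepT.
suff -> : U = ~` C by exact: SgC.
apply/seteqP; split=> x.
- have [y <-] := g_surj x => Uy; apply: CU.
  have [n nP] := near_radius (open_nbhs_nbhs (conj oV Uy)).
  by exists n => //; exists y.
- move=> nCx; apply: contrapT => nUx; apply: nCx; apply: UC; exists 0%N => //.
  by have [y yx] := g_surj x; exists y => //=; rewrite yx.
Qed.

End souslin.

(** * Products of parts and the final argument *)

Definition parts (R : realType) (X : Type) (F : set (X -> R[i])) :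
    set (X -> R) :=
  [set s | exists2 f, F f & s = @complex.Re R \o f \/ s = @complex.Im R \o f].

(** Multiply [f] by [h] and by its conjugate: half the sum and half the difference of the real parts
    give Re f Re h and Im f Im h, and the imaginary parts give the mixed products. *)
Lemma parts_mul (R : realType) (X : Type) (F : set (X -> R[i])) :
  mul_closed F -> conj_closed F -> forall s t, parts F s -> parts F t ->
  exists s1 s2 a b, [/\ parts F s1, parts F s2 &
    forall x, s x * t x = a * s1 x + b * s2 x].
Proof.
move=> Fmul Fconj s t [f Ff sE] [h Fh tE].
have Ffh := Fmul _ _ Ff Fh; have Ffh' := Fmul _ _ Ff (Fconj _ Fh).
have ReP k : F k -> parts F (@complex.Re R \o k) by exists k => //; left.
have ImP k : F k -> parts F (@complex.Im R \o k) by exists k => //; right.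
case: sE tE => -> [] ->.
- do 2 eexists; exists (2^-1), (2^-1); split;
    [exact: ReP Ffh|exact: ReP Ffh'|move=> x /=].
  by case: (f x) (h x) => a b [c e] /=; field.
- do 2 eexists; exists (2^-1), (- 2^-1); split;
    [exact: ImP Ffh|exact: ImP Ffh'|move=> x /=].
  by case: (f x) (h x) => a b [c e] /=; field.
- do 2 eexists; exists (2^-1), (2^-1); split;
    [exact: ImP Ffh|exact: ImP Ffh'|move=> x /=].
  by case: (f x) (h x) => a b [c e] /=; field.
- do 2 eexists; exists (- 2^-1), (2^-1); split;
    [exact: ReP Ffh|exact: ReP Ffh'|move=> x /=].
  by case: (f x) (h x) => a b [c e] /=; field.
Qed.

(** Once [seqDU] makes the cover disjoint, countable additivity suffices, without any finiteness. *)
Lemma eq_measure_on_cover d (T : measurableType d) (R : realType)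
    (mu1 mu2 : {measure set T -> \bar R}) (E : nat -> set T) :
  (forall n, measurable (E n)) -> (forall x, exists n, E n x) ->
  (forall n A, measurable A -> mu1 (A `&` E n) = mu2 (A `&` E n)) ->
  forall A, measurable A -> mu1 A = mu2 A.
Proof.
move=> mE covE eqE A mA.
have mD n : measurable (seqDU E n).
  by apply: measurableD => //; exact: bigsetU_measurable.
have AE : A = \bigcup_n (A `&` seqDU E n).
  rewrite -setI_bigcupr -seqDU_bigcup_eq; apply/esym/setIidPl => x _.
  by have [n] := covE x; exists n.
have tD : trivIset setT (fun n => A `&` seqDU E n).
  exact: trivIset_setIl (trivIset_seqDU E).
have mAD n : measurable (A `&` seqDU E n) by exact: measurableI.
rewrite AE !measure_bigcup//; apply: eq_eseriesr => n _.
have -> : A `&` seqDU E n = A `&` seqDU E n `&` E n.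
  by rewrite -setIA; congr (_ `&` _); apply/esym/setIidPl => x [].
exact: eqE.
Qed.

Theorem corollary2p8 (R : realType) (X : ptopologicalType)
    (F : set (X -> R[i]))
    (hX : souslin_space R X)
    (hF : F `<=` @Cb R X)
    (hmul : mul_closed F)
    (hconj : conj_closed F)
    (hsep : separates_points F)
    (hvan : vanishes_nowhere F) :
  separating_for F (measuresF F).
Proof.
move=> mu1 mu2 int1 int2 eq_int.
have [M [d [g [Mc dd cg gs]]]] := souslin_param hX.
have ReB : {morph (@complex.Re R) : z w / z - w} by move=> [? ?] [? ?].
have ImB : {morph (@complex.Im R) : z w / z - w} by move=> [? ?] [? ?].
have Sc s : parts F s -> continuous s.
  move=> [f /hF[cf _] [->|->]].
    exact: continuous_part ReB (@normr_Re_le R) cf.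
  exact: continuous_part ImB (@normr_Im_le R) cf.
have S_bm s : parts F s -> @bounded_measurable _ (borel X) R s.
  move=> Ps; split; first by apply: continuous_borel_measurable; exact: Sc.
  move: Ps => [f /hF[_ bf] [->|->]].
    exact: bounded_part (@normr_Re_le R) bf.
  exact: bounded_part (@normr_Im_le R) bf.
have normc_measurable f : F f ->
    measurable_fun [set: borel X] (fun x => Normc.normc (f x)).
  move=> Ff.
  have [mRe _] : @bounded_measurable _ (borel X) R (@complex.Re R \o f).
    by apply: S_bm; exists f => //; left.
  have [mIm _] : @bounded_measurable _ (borel X) R (@complex.Im R \o f).
    by apply: S_bm; exists f => //; right.
  rewrite (_ : (fun x => _) = Num.sqrt \o
    (fun x => (@complex.Re R \o f) x ^+ 2 + (@complex.Im R \o f) x ^+ 2)).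
    apply: measurableT_comp.
      by apply: continuous_measurable_fun; exact: sqrt_continuous.
    by apply: measurable_funD; exact: measurable_funX.
  by apply/funext => x /=; case: (f x).
have S_int1 (mu : {measure set (borel X) -> \bar R}) s : measuresF F mu ->
    parts F s -> mu.-integrable setT (EFin \o s).
  move=> Fmu Ps; have [ms _] := S_bm s Ps; case: Ps ms => f Ff sE ms.
  apply/integrableP; split; first exact/measurable_EFinP.
  apply: le_lt_trans (Fmu f Ff); apply: ge0_le_integral => //.
  - by apply: measurableT_comp => //; exact/measurable_EFinP.
  - by apply/measurable_EFinP; exact: normc_measurable.
  - move=> x _; rewrite /= lee_fin; case: sE => ->.
      exact: normr_Re_le.
    exact: normr_Im_le.
have S_int s (Ps : parts F s) := conj (S_int1 _ s int1 Ps) (S_int1 _ s int2 Ps).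
have S_eq s : parts F s ->
    (\int[mu1]_x (s x)%:E = \int[mu2]_x (s x)%:E)%E.
  move=> Ps; have [i1 i2] := S_int s Ps.
  (* [Rintegral] keeps only the finite part of an integral; equality lifts to extended reals because
     both integrals are finite. *)
  rewrite -(fineK (integrable_fin_num measurableT i1)).
  rewrite -(fineK (integrable_fin_num measurableT i2)).
  congr EFin; case: Ps => f Ff sE.
  have [Ref Imf] : _ := eq_int f Ff.
  by case: sE => ->.
have S_mul := parts_mul hmul hconj.
have Sg_sigma := @sigma_algebra_multiplier_set _ (borel X) R mu1 mu2 (parts F)
  S_bm S_int.
have Ssep x y : x <> y -> exists2 s, parts F s & s x <> s y.
  move=> /hsep[f Ff fxy]; apply: contrapT => nS; apply: fxy.
  apply/eqP; rewrite eq_complex; apply/andP; split; apply/eqP; apply: contrapT.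
    move=> ne; apply: nS; exists (@complex.Re R \o f) => //.
    by exists f => //; left.
  move=> ne; apply: nS; exists (@complex.Im R \o f) => //.
  by exists f => //; right.
have open_mult : open `<=` @multiplier_set _ (borel X) R mu1 mu2 (parts F).
  apply: (souslin_open_sub Mc dd cg gs Sg_sigma Sc _ Ssep) => s a Ps.
  by apply: multiplier_set_gt => //; exact: multiplier_mem.
have borel_mult (A : set (borel X)) :
    measurable A -> @multiplier_set _ (borel X) R mu1 mu2 (parts F) A.
  by move/(smallest_sub Sg_sigma open_mult).
pose S := [set s | parts F s /\ forall x, 0 <= s x].
have ReMC z : complex.Re (z * z^*%C) = complex.Re z ^+ 2 + complex.Im z ^+ 2.
  by case: z => a b /=; ring.
(* The product of [f] with its conjugate is in [F], and its real part is the squared modulus of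
   [f]. *)
have Snz x : exists2 s, S s & s x != 0.
  have [f Ff fx] := hvan x.
  exists (@complex.Re R \o (fun x => f x * (f x)^*%C)).
    split; last by move=> y; rewrite /= ReMC addr_ge0 ?sqr_ge0.
    by exists (fun x => f x * (f x)^*%C); [exact: hmul Ff (hconj _ Ff)|left].
  rewrite /= ReMC paddr_eq0 ?sqr_ge0// !sqrf_eq0; apply: contra_notN fx.
  by case: (f x) => a b /= /andP[/eqP -> /eqP ->].
have [|||w wS wnz] := @souslin_lindelof R X M d g dd cg gs S.
- by have [s] := Snz point; exists s.
- by move=> s [/Sc].
- exact: Snz.
apply: (@eq_measure_on_cover _ (borel X) R mu1 mu2
  (fun n => [set x | w n x != 0])).
- move=> n; apply: sub_sigma_algebra.
  apply: (@open_comp X R (w n) [set t | t != 0]); last exact: open_neq.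
  by move=> y _; have [/Sc] := wS n; exact.
- exact: wnz.
- move=> n A mA; have [Pw w0] := wS n.
  exact: (@eq_measure_multiplier_set _ (borel X) R mu1 mu2 (parts F)
    S_bm S_int S_eq S_mul A (w n) (borel_mult A mA) Pw w0).
Qed.
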